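(* Let $q$ be a complex number with $0<|q|<1$. Let $(\alpha_n,\beta_n)_{n\ge 0}$ be a Bailey pair relative to $q$, and let $(f_n)_{n\in\mathbb{Z}}$ be a sequence defined for all integers $n$ which satisfies $$\alpha_n=\frac{1-q^{2n+1}}{1-q}f_n\qquad (n\geq 0)$$ and $$q^{n}f_n=-q^{-n-1}f_{-n-1}\qquad (n\in\mathbb{Z}).$$ Then for all integers $m\ge 1$ and $0\le a\le m$ (such that the multiple series on the left and the series on the right below converge absolutely), we have $$\sum_{n_m,\dots,n_1\ge 0}\frac{q^{\binom{n_m+1}{2}+\cdots+\binom{n_1+1}{2}}(q^2;q^2)_{n_1+\delta_{a,0}}}{(q)_{n_m}}\,\beta_{n_1+\delta_{a,0}}\prod_{i=1}^{m-1}\begin{bmatrix} n_{i+1}+\delta_{a,i}\\ n_i\end{bmatrix}=\frac{(-q)_\infty}{(q)_\infty}\sum_{n\in\mathbb{Z}}q^{m\binom{n}{2}+an}f_n.$$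
   Context: Notation: $(x;p)_n=\prod_{j=0}^{n-1}(1-xp^j)$ for $n\ge 0$, $(x;p)_\infty=\prod_{j\ge 0}(1-xp^j)$, and $(x)_n=(x;q)_n$, $(x)_\infty=(x;q)_\infty$. The $q$-binomial coefficient is $\begin{bmatrix} n\\k\end{bmatrix}=\frac{(q)_n}{(q)_{n-k}(q)_k}$ if $0\le k\le n$, and $0$ otherwise. $\binom{n}{2}=n(n-1)/2$ for every integer $n$; $\delta_{i,j}$ is the Kronecker delta; empty products equal $1$. A Bailey pair relative to $x$ is a pair of sequences $(\alpha_n,\beta_n)_{n\ge 0}$ satisfying $\beta_n=\sum_{k=0}^n\frac{\alpha_k}{(q)_{n-k}(xq)_{n+k}}$ for all $n\ge 0$. *)

(* Defs.v *)
From mathcomp Require Import all_boot all_order all_algebra.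
From mathcomp Require Import finmap complex.
From mathcomp Require Import all_classical all_reals all_analysis.
From mathcomp Require analysis.showcase.summability.

Set Implicit Arguments.
Unset Strict Implicit.
Unset Printing Implicit Defensive.

Import Order.TTheory GRing.Theory Num.Theory.
Import numFieldNormedType.Exports.

Local Open Scope classical_set_scope.
Local Open Scope ring_scope.
Local Open Scope complex_scope.

Section Series.
Variable R : realType.

(* Limits are taken in [R[i]^o]: the topology of the modulus is attached to the
   regular module, not to [R[i]] itself. *)
Definition csum (I : choiceType) (x : I -> R[i]) : R[i] :=
  summability.sum (x : I -> R[i]^o).

(* The modulus of a complex number is again of type [R[i]], with zero imaginary
   part; [Re] reads it as an element of [R]. *)
Definition abs_summable (I : choiceType) (x : I -> R[i]) : Prop :=
  summable [set: I] (fun i => (complex.Re `|x i|)%:E).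

Definition qpoch (x p : R[i]) (n : nat) : R[i] :=
  \prod_(j < n) (1 - x * p ^+ j).

Definition qpoch_inf (x p : R[i]) : R[i] :=
  lim ((fun n => qpoch x p n : R[i]^o) @ \oo).

Definition qbinom (q : R[i]) (n k : nat) : R[i] :=
  if (k <= n)%N then qpoch q q n / (qpoch q q (n - k) * qpoch q q k) else 0.

Definition bailey_pair (q x : R[i]) (alpha beta : nat -> R[i]) : Prop :=
  forall n : nat,
    beta n = \sum_(k < n.+1)
               alpha k / (qpoch q q (n - k) * qpoch (x * q) q (n + k)).

Definition binz2 (n : int) : int := (n * (n - 1) %/ 2)%Z.

(* The tuple [s] lists [n_1, ..., n_m] in this order, so [n_i] is its entry
   number [i - 1]. *)
Definition multisum_term (q : R[i]) (beta : nat -> R[i]) (m a : nat)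
    (s : m.-tuple nat) : R[i] :=
  let n i := nth 0%N s i.-1 in
  q ^+ (\sum_(1 <= i < m.+1) 'C((n i).+1, 2))
  * qpoch (q ^+ 2) (q ^+ 2) (n 1 + (a == 0))%N / qpoch q q (n m)
  * beta (n 1 + (a == 0))%N
  * \prod_(1 <= i < m) qbinom q (n i.+1 + (a == i))%N (n i).

Definition bilateral_term (q : R[i]) (f : int -> R[i]) (m a : nat)
    (n : int) : R[i] :=
  q ^ (m%:Z * binz2 n + a%:Z * n) * f n.

End Series.

Arguments multisum_term {R} q beta m a s.

(* Main.v *)
Require Import Defs.
From mathcomp Require Import all_boot all_order all_algebra.
From mathcomp Require Import finmap complex.
From mathcomp Require Import all_classical all_reals all_analysis.
From mathcomp Require Import ring lra zify.

Set Implicit Arguments.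
Unset Strict Implicit.
Unset Printing Implicit Defensive.

Import Order.TTheory GRing.Theory Num.Theory.
Import numFieldNormedType.Exports.
Local Open Scope classical_set_scope.
Local Open Scope ring_scope.
Local Open Scope complex_scope.

(** Write [(q)_n] for [qpoch q q n] and let
    [K_k(n) = (-q)_n (q)_n / ((q)_(n-k) (q)_(n+k+1))]; this kernel is invariant
    under [k -> -k-1]. In terms of it, the Bailey pair relation reads
    [(q^2;q^2)_n beta_n = sum_k (1 - q^(2k+1)) f_k K_k(n)]. By q-Chu-Vandermonde,
    [K_k] is an eigenfunction, with eigenvalue [q^C(k+1,2)], of the operator
    [H |-> (n |-> sum_r q^C(r+1,2) [n;r] H(r))], which is one summation of the
    multiple series. The shift [n -> n+1] caused by [delta_(a,i)] sends
    [(1 - q^(2k+1)) K_k] to [K_(k-1) - q^(2k+1) K_(k+1)], again a combination of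
    eigenfunctions. Thus, with [1/(q)_(n_m)] replaced by the q-binomial
    [[n + delta_(a,m); n_m]], the multiple series is a finite sum equal to a finite
    bilateral sum. Letting [n] tend to infinity by dominated convergence on each
    side separately gives the identity, with no exchange of infinite sums. *)

(** * Finite identities *)

Lemma bin2D m n : 'C(m + n, 2) = ('C(m, 2) + m * n + 'C(n, 2))%N.
Proof.
elim: n => [|n IH]; first by rewrite muln0 bin0n !addn0.
by rewrite addnS !binS !bin1 IH mulnS; lia.
Qed.

Section Finite.
Variable R : realType.
Implicit Types (q x p : R[i]).

Lemma qpoch0 x p : qpoch x p 0 = 1 :> R[i].
Proof. by rewrite /qpoch big_ord0. Qed.

Lemma qpochSr x p n : qpoch x p n.+1 = qpoch x p n * (1 - x * p ^+ n) :> R[i].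
Proof. by rewrite /qpoch big_ord_recr. Qed.

Lemma qpochD x p n k :
  qpoch x p (n + k) = qpoch x p n * qpoch (x * p ^+ n) p k :> R[i].
Proof.
elim: k => [|k IH]; first by rewrite addn0 qpoch0 mulr1.
by rewrite addnS !qpochSr IH -!mulrA exprD.
Qed.

Lemma qpochSl x p n : qpoch x p n.+1 = (1 - x) * qpoch (x * p) p n :> R[i].
Proof. by rewrite -add1n qpochD qpochSr qpoch0 expr0 expr1 mulr1 mul1r. Qed.

Lemma qpoch_sqr q n :
  qpoch (q ^+ 2) (q ^+ 2) n = qpoch q q n * qpoch (- q) q n.
Proof.
elim: n => [|n IH]; first by rewrite !qpoch0 mulr1.
rewrite !qpochSr IH -exprM mulnC exprM; ring.
Qed.

Variable q : R[i].
Hypothesis qq_neq0 : forall n, qpoch q q n != 0.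

Lemma qbinom0 n : qbinom q n 0 = 1.
Proof. by rewrite /qbinom subn0 qpoch0 mulr1 divff. Qed.

Lemma qbinom_small n k : (n < k)%N -> qbinom q n k = 0.
Proof. by rewrite /qbinom ltnNge => /negbTE ->. Qed.

Lemma qbinomS n k :
  qbinom q n.+1 k.+1 = qbinom q n k.+1 + q ^+ (n - k) * qbinom q n k.
Proof.
case: (ltngtP k n) => [kn|nk|->]; last 2 first.
- by rewrite !qbinom_small ?mulr0 ?addr0 // ltnW.
- rewrite (@qbinom_small n n.+1) // add0r subnn mul1r /qbinom !leqnn !subnn.
  by rewrite qpoch0 !mul1r !divff.
rewrite /qbinom !ltnS kn ltnW //.
have [d ->] : exists d, n = (k + d.+1)%N.
  by exists (n - k.+1)%N; rewrite addnS -addSn subnKC.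
rewrite subSS addKn.
have -> : (k + d.+1 - k.+1 = d)%N by rewrite addnS subSS addKn.
have Hk := qq_neq0 k; have Hd := qq_neq0 d.
have Hk1 := qq_neq0 k.+1; have Hd1 := qq_neq0 d.+1.
rewrite !qpochSr -!exprS in Hk1 Hd1 *.
rewrite -addnS exprD -[q ^+ d.+2]mulr1 [q ^+ k.+1]exprS [q ^+ d.+1]exprS.
rewrite !exprS in Hk1 Hd1 *.
rewrite !mulf_eq0 !negb_or in Hk1 Hd1.
case/andP: Hk1 => _ Hk1; case/andP: Hd1 => _ Hd1.
by field; rewrite Hk Hd Hk1 Hd1.
Qed.

(* The limiting case of the q-Chu-Vandermonde sum with c = a b. *)
Lemma qvandermonde n (a b : R[i]) :
  \sum_(j < n.+1) qbinom q n j * qpoch a q j * (- b) ^+ j * q ^+ 'C(j, 2)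
     * qpoch (a * b * q ^+ j) q (n - j) = qpoch b q n.
Proof.
elim: n a b => [|n IH] a b.
  by rewrite big_ord1 qbinom0 !qpoch0 !mulr1.
rewrite big_ord_recl.
under eq_bigr => i _.
  rewrite lift0 qbinomS !mulrDl subSS.
  over.
rewrite big_split /= addrA.
set s1 := (X in X + _ = _); set s2 := (X in _ + X = _).
(* After the q-Pascal split, [s1] is a multiple of the sum for [n] with the same [a], [b], and [s2]
   of the sum with [a * q] for [a]; the two factors add up to 1 - b q^n. *)
have -> : s1 = (1 - a * b * q ^+ n) * qpoch b q n.
  rewrite -(IH a) /s1 big_ord_recr /= (@qbinom_small n n.+1) // !mul0r addr0.
  rewrite mulr_sumr big_ord_recl /= !qbinom0 !subn0 qpochSr expr0 mulr1.
  rewrite -!mulrA; congr (_ + _).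
    by rewrite !qpoch0 !mul1r mulrC.
  apply: eq_bigr => i _; rewrite ?lift0 /bump /= ?add1n.
  have ltin := ltn_ord i.
  rewrite -[(n - i)%N]prednK ?subn_gt0 // -subnS (qpochSr (_ * q ^+ i.+1)).
  have -> : a * b * q ^+ i.+1 * q ^+ (n - i.+1) = a * b * q ^+ n.
    by rewrite -mulrA -exprD subnKC.
  by ring.
have -> : s2 = - b * (1 - a) * q ^+ n * qpoch b q n.
  rewrite -(IH (a * q)) mulr_sumr; apply: eq_bigr => i _.
  have lein : (i <= n)%N by rewrite -ltnS.
  rewrite qpochSl binS bin1 exprD exprS.
  have -> : q ^+ n = q ^+ (n - i) * q ^+ i by rewrite -exprD subnK.
  have -> : a * q * b * q ^+ i = a * b * q ^+ i.+1 by rewrite exprS; ring.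
  by ring.
by rewrite qpochSr; ring.
Qed.

(** The value 0 for [k > n] is the convention 1/(q)_(n-k) = 0, which truncated subtraction would
    lose. *)
Definition qker (k n : nat) : R[i] :=
  if (k <= n)%N
  then qpoch (- q) q n * qpoch q q n / (qpoch q q (n - k) * qpoch q q (n + k).+1)
  else 0.

(** A cutoff [B] independent of [n] lets iterated steps become one sum over tuples; the q-binomial
    vanishes for [r > n], so the value does not depend on [B] once [n < B]. *)
Definition bailey_step (B : nat) (H : nat -> R[i]) (n : nat) : R[i] :=
  \sum_(r < B) q ^+ 'C(r.+1, 2) * qbinom q n r * H r.

(** With n = k + N and r = k + i this is [qvandermonde] at a = b = -q^(k+1): the factor (a b
    q^i)_(N-i) completes (q)_(2k+1+i) to (q)_(2k+1+N), and q^C(k+i+1,2) splits off the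
    eigenvalue. *)
Lemma bailey_step_qker B k n : (n < B)%N ->
  bailey_step B (qker k) n = q ^+ 'C(k.+1, 2) * qker k n.
Proof.
move=> nB; rewrite /bailey_step.
transitivity (\sum_(r < n.+1) q ^+ 'C(r.+1, 2) * qbinom q n r * qker k r).
  rewrite [RHS](big_ord_widen B
    (fun r => q ^+ 'C(r.+1, 2) * qbinom q n r * qker k r)) //.
  rewrite [RHS]big_mkcond; apply: eq_bigr => r _; rewrite ltnS.
  by case: leqP => // /qbinom_small ->; rewrite mulr0 mul0r.
have [kn|nk] := leqP k n; last first.
  rewrite big1 => [|r _]; first by rewrite /qker leqNgt nk mulr0.
  by rewrite /qker leqNgt (leq_trans (ltn_ord r) nk) mulr0.
have [N nE] : exists N, n = (k + N)%N by exists (n - k)%N; rewrite subnKC.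
rewrite nE -addnS big_split_ord /= big1 ?add0r; last first.
  by move=> r _; rewrite /qker leqNgt ltn_ord mulr0.
rewrite /qker leq_addr addKn.
have := qvandermonde N (- q ^+ k.+1) (- q ^+ k.+1).
have -> : - q ^+ k.+1 * - q ^+ k.+1 = q * q ^+ (k + k).+1.
  by rewrite mulrNN -exprD -exprS addSn addnS.
rewrite opprK => vdm.
have -> : (k + N + k).+1 = ((k + k).+1 + N)%N by lia.
rewrite (qpochD (- q)) mulNr -exprS -vdm !mulr_sumr 2!mulr_suml mulr_sumr.
apply: eq_bigr => i _; have iN : (i <= N)%N by rewrite -ltnS.
rewrite leq_addr addKn /qbinom iN leq_add2l iN subnDl.
have -> : (k + i + k).+1 = ((k + k).+1 + i)%N by lia.
rewrite (qpochD (- q)) mulNr -exprS -mulrA -exprD.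
have E : qpoch q q ((k + k).+1 + N)
   = qpoch q q ((k + k).+1 + i) * qpoch (q * q ^+ ((k + k).+1 + i)) q (N - i).
  by rewrite -qpochD -addnA subnKC.
have -> : q ^+ 'C((k + i).+1, 2)
    = q ^+ 'C(k.+1, 2) * (q ^+ k.+1) ^+ i * q ^+ 'C(i, 2).
  rewrite -exprM -!exprD; congr (q ^+ _).
  by rewrite -addSn bin2D.
have := qq_neq0 ((k + k).+1 + N); rewrite E mulf_eq0 negb_or => /andP[H1 H2].
have H3 := qq_neq0 (N - i); have H4 := qq_neq0 i; have H5 := qq_neq0 (k + i).
have H6 := qq_neq0 N.
rewrite -?exprS ?addSn in H1 H2 *.
by field; rewrite H1 H2 H3 H4 H5 H6.
Qed.

Lemma qker_shift k n :
  (1 - q ^+ (2 * k + 1)) * qker k n.+1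
  = qker k.-1 n - q ^+ (2 * k + 1) * qker k.+1 n.
Proof.
have [kn|nk] := leqP k n.+1; last first.
  have [H1 H2] : (k <= n.+1)%N = false /\ (k.-1 <= n)%N = false by lia.
  have H3 : (k < n)%N = false by lia.
  by rewrite /qker H1 H2 H3 !mulr0 subr0.
have P0 := qq_neq0.
set W := qpoch (- q) q n * qpoch q q n / (qpoch q q (n.+1 - k) * qpoch q q (n + k).+2).
have -> : qker k n.+1 = (1 - q ^+ n.+1 * q ^+ n.+1) * W.
  rewrite /qker kn /W addSn (qpochSr _ q n) (qpochSr _ q n) mulNr -exprS.
  ring.
have -> : qker k.-1 n = (1 - q ^+ (n + k).+1) * (1 - q ^+ (n + k).+2) * W.
  case: k kn @W => [|k] kn W.
    have := P0 n.+2; rewrite /qker /W subn0 !addn0 leq0n subn0 /=.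
    rewrite !qpochSr -!exprS !mulf_eq0 !negb_or => /andP[/andP[H1 H2] H3].
    by field; rewrite H1 H2 H3.
  have := P0 (n + k.+1).+2; rewrite /qker /W /= -ltnS kn subSS addnS.
  rewrite !qpochSr -!exprS !mulf_eq0 !negb_or.
  move=> /andP[/andP[/andP[H1 H2] H3] H4].
  by field; rewrite H1 H2 H3 H4 P0.
have -> : qker k.+1 n = (1 - q ^+ (n - k)) * (1 - q ^+ (n.+1 - k)) * W.
  rewrite /qker; case: ltnP => [ltkn|lenk]; last first.
    have [->|->] : (n - k = 0 \/ n.+1 - k = 0)%N by lia.
      by rewrite subrr !mul0r.
    by rewrite subrr mulr0 mul0r.
  rewrite /W.
  have -> : (n.+1 - k)%N = (n - k.+1).+2 by lia.
  have -> : (n - k)%N = (n - k.+1).+1 by lia.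
  have := P0 (n - k.+1).+2; rewrite addnS.
  rewrite !(qpochSr _ _ (n - k.+1).+1) !(qpochSr _ _ (n - k.+1)) -!exprS.
  rewrite !mulf_eq0 !negb_or => /andP[/andP[H1 H2] H3].
  by field; rewrite H1 H2 H3 P0.
suff K : (1 - q ^+ (2 * k + 1)) * (1 - q ^+ n.+1 * q ^+ n.+1)
    = (1 - q ^+ (n + k).+1) * (1 - q ^+ (n + k).+2)
      - q ^+ (2 * k + 1) * ((1 - q ^+ (n - k)) * (1 - q ^+ (n.+1 - k))).
  by rewrite mulrA K mulrBl -!mulrA.
have -> : q ^+ (n + k).+1 = q ^+ n.+1 * q ^+ k by rewrite -exprD.
have -> : q ^+ (n + k).+2 = q ^+ n.+1 * q ^+ k.+1 by rewrite -exprD addnS.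
have -> : q ^+ (2 * k + 1) = q ^+ k * q ^+ k.+1 by rewrite -exprD; congr (q ^+ _); lia.
(* At k = n + 1 the truncated [n - k] is not the true exponent -1, but the factor 1 - q^(n+1-k)
   vanishes. *)
move: kn; rewrite leq_eqVlt => /predU1P[->|]; first by rewrite subnn; ring.
rewrite ltnS => kn; rewrite subSn // [q ^+ n.+1]exprS [q ^+ (n - k).+1]exprS.
by rewrite -{1 2 3 4}(subnK kn) exprD exprS; ring.
Qed.

Lemma bailey_step_sum B (I : Type) (r : seq I) (c : I -> R[i])
    (H : I -> nat -> R[i]) n :
  bailey_step B (fun l => \sum_(i <- r) c i * H i l) n
  = \sum_(i <- r) c i * bailey_step B (H i) n.
Proof.
rewrite /bailey_step; under eq_bigr do rewrite mulr_sumr.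
rewrite exchange_big; apply: eq_bigr => i _ /=; rewrite mulr_sumr.
by apply: eq_bigr => l _; rewrite mulrCA.
Qed.

Lemma eq_bailey_step B (H1 H2 : nat -> R[i]) n :
  (forall r, (r <= n)%N -> H1 r = H2 r) ->
  bailey_step B H1 n = bailey_step B H2 n.
Proof.
move=> E; apply: eq_bigr => r _; have [rn|nr] := leqP r n; first by rewrite E.
by rewrite qbinom_small // mulr0 !mul0r.
Qed.

(* The contribution of [f_k] after [i] of the [m] summations. In the second branch
   the truncated [k.-1] is intended: at [k = 0] the kernel of index [-1] is the
   kernel of index [0]. *)
Definition bailey_level (a i k n : nat) : R[i] :=
  if (i < a)%N
  then (1 - q ^+ (2 * k + 1)) * (q ^+ 'C(k.+1, 2)) ^+ i * qker k n
  else (q ^+ 'C(k.+1, 2)) ^+ a *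
    ((q ^+ 'C(k, 2)) ^+ (i - a) * qker k.-1 n
     - q ^+ (2 * k + 1) * (q ^+ 'C(k.+2, 2)) ^+ (i - a) * qker k.+1 n).

Lemma bailey_level0 a k n :
  bailey_level a 0 k n = (1 - q ^+ (2 * k + 1)) * qker k (n + (a == 0)%N).
Proof.
rewrite /bailey_level; case: a => [|a] /=; last by rewrite addn0 expr0 mulr1.
by rewrite subnn !expr0 !mul1r mulr1 (addn1 n) qker_shift.
Qed.

(** Past [a], K_(k-1) and K_(k+1) each gain their eigenvalue; at step [a], K_k gains its own and
    [qker_shift] absorbs the argument n + 1; before [a], K_k just gains its eigenvalue. *)
Lemma bailey_step_bailey_level B a i k n : (n + (a == i.+1) < B)%N ->
  bailey_step B (bailey_level a i k) (n + (a == i.+1)) = bailey_level a i.+1 k n.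
Proof.
move=> nB; rewrite /bailey_level; case: (ltngtP i.+1 a) nB => [ia|ai|<-]; last 2 first.
- rewrite addn0 => nB.
  (* At k = 0, where [k.-1] truncates, both binomials are 0. *)
  have Ek : q ^+ 'C(k.-1.+1, 2) = q ^+ 'C(k, 2) by case: (k).
  transitivity ((q ^+ 'C(k.+1, 2)) ^+ a * ((q ^+ 'C(k, 2)) ^+ (i - a) *
    bailey_step B (qker k.-1) n - q ^+ (2 * k + 1) *
    (q ^+ 'C(k.+2, 2)) ^+ (i - a) * bailey_step B (qker k.+1) n)).
    rewrite /bailey_step !mulr_sumr -sumrB mulr_sumr.
    by apply: eq_bigr => r _; ring.
  by rewrite !bailey_step_qker // Ek subSn // !exprS; ring.
- rewrite (addn1 n) subnn !expr0 !mul1r mulr1 => nB.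
  transitivity ((1 - q ^+ (2 * k + 1)) * (q ^+ 'C(k.+1, 2)) ^+ i *
     bailey_step B (qker k) n.+1).
    by rewrite /bailey_step !mulr_sumr; apply: eq_bigr => r _; ring.
  by rewrite bailey_step_qker // -qker_shift exprS; ring.
rewrite addn0 => nB.
transitivity ((1 - q ^+ (2 * k + 1)) * (q ^+ 'C(k.+1, 2)) ^+ i *
   bailey_step B (qker k) n).
  by rewrite /bailey_step !mulr_sumr; apply: eq_bigr => r _; ring.
by rewrite bailey_step_qker // exprS; ring.
Qed.

(* [i] is the number of the next summation index to be summed, [m] the number of
   those that remain. *)
Fixpoint bailey_steps (B a i m : nat) (H : nat -> R[i]) : nat -> R[i] :=
  if m is m'.+1
  then bailey_steps B a i.+1 m' (fun n => bailey_step B H (n + (a == i)))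
  else H.

(** Each step raises the argument by at most one, through the shift, so an expansion of [H] up to n
    + m suffices for m steps evaluated at n. *)
Lemma bailey_steps_level B K a i m (c : nat -> R[i]) (H : nat -> R[i]) n :
  (n + m < B)%N ->
  (forall l, (l <= n + m)%N -> H l = \sum_(k < K) c k * bailey_level a i k l) ->
  bailey_steps B a i.+1 m H n = \sum_(k < K) c k * bailey_level a (i + m) k n.
Proof.
elim: m i H => [|m IH] i H nB HE; first by rewrite /= HE ?addn0.
rewrite /= addnS -addSn; apply: IH => [|l ln]; first by rewrite addnS in nB; lia.
rewrite (@eq_bailey_step _ _ (fun l => \sum_(k < K) c k * bailey_level a i k l)).
  rewrite bailey_step_sum; apply: eq_bigr => k _.
  by rewrite bailey_step_bailey_level //; case: eqP => _; lia.
by move=> r rl; apply: HE; move: rl; case: eqP => _; lia.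
Qed.

(* Entry [j] of [s] is the summation index n_(i + j), and n_(i + size s) is
   read as [n]. *)
Definition chain (a i : nat) (s : seq nat) (n : nat) : R[i] :=
  \prod_(j < size s) (q ^+ 'C((nth n s j).+1, 2)
    * qbinom q (nth n s j.+1 + (a == i + j)%N) (nth n s j)).

Lemma chain_cons a i r s n :
  chain a i (r :: s) n = q ^+ 'C(r.+1, 2) * qbinom q (head n s + (a == i)) r
                         * chain a i.+1 s n.
Proof.
rewrite /chain /= big_ord_recl /= addn0 nth0; congr (_ * _).
by apply: eq_bigr => j _; rewrite /bump /= add1n addnS.
Qed.

Lemma sum_tuple_cons (T : finType) m (F : seq T -> R[i]) :
  \sum_(s : m.+1.-tuple T) F s = \sum_(s : m.-tuple T) \sum_(x : T) F (x :: s).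
Proof.
rewrite exchange_big pair_big /=.
rewrite (reindex (fun p : T * m.-tuple T => cons_tuple p.1 p.2)) //=.
exists (fun s => (thead s, behead_tuple s)) => [[x s] _|s _] /=.
  by congr (_, _); apply: val_inj.
by rewrite [in RHS](tuple_eta s); apply: val_inj.
Qed.

(** The head of the tuple is summed first: with the rest fixed, its sum is one [bailey_step] applied
    to [H]. *)
Lemma sum_chain B a i m (H : nat -> R[i]) n :
  \sum_(s : m.-tuple 'I_B) H (head n (map (@nat_of_ord B) s))
     * chain a i (map (@nat_of_ord B) s) n
  = bailey_steps B a i m H n.
Proof.
elim: m i H => [|m IH] i H.
  rewrite (big_pred1 [tuple]) => [|s]; last exact/esym/eqP/tuple0.
  by rewrite /= /chain big_ord0 mulr1.
rewrite (sum_tuple_cons m (fun s : seq 'I_B =>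
  H (head n (map (@nat_of_ord B) s)) * chain a i (map (@nat_of_ord B) s) n)).
rewrite /= -IH; apply: eq_bigr => s _.
rewrite /bailey_step mulr_suml; apply: eq_bigr => r _ /=.
by rewrite chain_cons; ring.
Qed.

(** The factor 1/(1-q) of alpha turns (q^2;q)_(n+k) into (q)_(n+k+1). As K_k(n) = 0 for k > n, the
    cutoff [K] is free, and one cutoff can serve many n. *)
Lemma bailey_pair_qker alpha beta (f : nat -> R[i]) K n :
  bailey_pair q q alpha beta ->
  (forall n, alpha n = (1 - q ^+ (2 * n + 1)) / (1 - q) * f n) -> (n < K)%N ->
  qpoch (q ^+ 2) (q ^+ 2) n * beta n
  = \sum_(k < K) f k * ((1 - q ^+ (2 * k + 1)) * qker k n).
Proof.
move=> -> alphaE nK.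
rewrite -(subnKC nK) big_split_ord /= [X in _ = _ + X]big1 ?addr0; last first.
  by move=> k _; rewrite /qker leqNgt addSn ltnS leq_addr !mulr0.
rewrite mulr_sumr; apply: eq_bigr => k _; have kn : (k <= n)%N by rewrite -ltnS.
rewrite alphaE /qker kn qpoch_sqr qpochSl.
have := qq_neq0 (n + k).+1; rewrite qpochSl mulf_eq0 negb_or => /andP[H1 H2].
by field; rewrite H1 H2 qq_neq0.
Qed.

End Finite.

(** * Dominated convergence for complex sums *)

Lemma sum_fsubset (I : choiceType) (V : zmodType) (J A : {fset I}) (F : I -> V) :
  (J `<=` A)%fset ->
  \sum_(i <- A) F i = \sum_(i <- J) F i + \sum_(i <- (A `\` J)%fset) F i.
Proof.
move=> /fsubsetP JA; rewrite (big_fsetID _ (mem J)) /=.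
congr (_ + _); apply: eq_fbigl => i; rewrite !inE /= andbC //.
by apply/andP/idP => [[]//|iJ]; split=> //; apply: JA.
Qed.

Section Convergence.
Variable R : realType.

Lemma normcE_Re (z : R[i]) : `|z| = (complex.Re `|z|)%:C.
Proof. by rewrite normc_def. Qed.

Lemma gt0_complexP (e : R[i]) : 0 < e -> exists2 d : R, 0 < d & e = d%:C.
Proof.
move=> e0; have /gtr0_norm <- := e0.
by exists (complex.Re `|e|); rewrite -?ltcR -?normcE_Re ?normr_gt0 ?gt_eqF.
Qed.

Lemma normcR (x : R) : `|x%:C| = `|x|%:C.
Proof. by rewrite normc_def /= expr0n addr0 sqrtr_sqr. Qed.

Lemma normc_i : `|'i%C : R[i]| = 1.
Proof. by rewrite normc_def /= expr0n expr1n add0r sqrtr1. Qed.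

Lemma normc_ge_Im (z : R[i]) : `|complex.Im z|%:C <= `|z|.
Proof.
have -> : complex.Im z = - complex.Re (z * 'i%C) by rewrite ReiNIm opprK.
by rewrite normrN (le_trans (normc_ge_Re _)) // normrM normc_i mulr1.
Qed.

(* The library does not equip [R[i]^o] with a complete uniform structure. *)
Lemma cauchy_cvgc (T : Type) (F : set_system T) {FF : ProperFilter F}
    (u : T -> R[i]^o) :
  (forall e : R[i], 0 < e -> exists z : R[i], \forall t \near F, `|u t - z| < e) ->
  cvg (u @ F).
Proof.
move=> cu.
(* Real and imaginary parts are both additive contractions, so one argument from the completeness of
   [R] serves for both. *)
have cR (g : {additive R[i] -> R}) : (forall z, `|g z|%:C <= `|z|) ->
    cvg ((g \o u : T -> R) @ F).
  move=> gle; apply/cauchy_cvgP/cauchy_exP => e e0.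
  have [|z Fz] := cu e%:C; first by rewrite ltcR.
  exists (g z); rewrite /= !near_simpl; near=> t; rewrite /ball /= -ltcR distrC -raddfB.
  by rewrite (le_lt_trans (gle _)) //; near: t.
have /cR cvgRe := @normc_ge_Re R.
have /cR cvgIm := normc_ge_Im.
pose l : R[i] := lim ((@complex.Re R \o u : T -> R) @ F)
  +i* lim ((@complex.Im R \o u : T -> R) @ F).
suff : u @ F --> (l : R[i]^o) by move/cvgP.
apply/cvgrPdist_lt => e /gt0_complexP[d d0 ->].
have d20 : 0 < d / 2 by rewrite divr_gt0.
move/cvgrPdist_lt/(_ _ d20) in cvgRe; move/cvgrPdist_lt/(_ _ d20) in cvgIm.
near=> t.
rewrite (complexE (l - u t)) (le_lt_trans (ler_normD _ _)) // normrM.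
rewrite normc_i mul1r.
rewrite !normcR -rmorphD /= ltcR (splitr d).
have [-> ->] : complex.Re (l - u t) = complex.Re l - complex.Re (u t)
    /\ complex.Im (l - u t) = complex.Im l - complex.Im (u t) by case: (u t).
by apply: ltrD; near: t.
Unshelve. all: by end_near. Qed.

(** Take [J] with partial sum within e of the supremum: adding a disjoint [A] cannot push it past
    the supremum. *)
Lemma abs_summable_tail (I : choiceType) (x : I -> R[i]) : abs_summable x ->
  forall e : R[i], 0 < e -> exists J : {fset I},
    forall A : {fset I}, [disjoint A & J]%fset -> \sum_(i <- A) `|x i| < e.
Proof.
move=> sx _ /gt0_complexP[d d0 ->].
have fsumE (A : {fset I}) : (\sum_(i \in [set` A]) `|(complex.Re `|x i|)%:E| =
    (\sum_(i <- A) complex.Re `|x i|)%:E)%E.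
  rewrite fsbig_finite // set_fsetK -sumEFin; apply: eq_bigr => i _ /=.
  by rewrite ger0_norm // -ler0c -normcE_Re.
have finS : (\esum_(i in [set: I]) `|(complex.Re `|x i|)%:E|)%E \is a fin_num.
  by rewrite -summableE.
have [_ [/= S [finS' _] <-]] := ub_ereal_sup_adherent d0 finS.
move: finS'; rewrite finite_fsetP => -[J ->]; rewrite fsumE => lte.
exists J => A dAJ.
have le : ((\sum_(i <- (A `|` J)%fset) complex.Re `|x i|)%:E
    <= \esum_(i in [set: I]) `|(complex.Re `|x i|)%:E|)%E.
  by rewrite -fsumE; apply: esum_ge; exists [set` (A `|` J)%fset].
have JU : (J `<=` A `|` J)%fset by rewrite fsubsetUr.
have dE : ((A `|` J) `\` J = A)%fset.
  by rewrite fsetDUl fsetDv fsetU0; apply/fsetDidPl.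
rewrite (sum_fsubset _ JU) dE in le.
move: finS lte le; rewrite /esum; case: (ereal_sup _) => // s _.
rewrite -EFinB lte_fin lee_fin => lte le.
under eq_bigr do rewrite normcE_Re.
by rewrite -rmorph_sum /= ltcR; lra.
Qed.

(** The tail bound makes the net of partial sums Cauchy; [A] and any larger set differ only outside
    [J], and the bound e survives, non-strictly, in the limit. *)
Lemma csum_approx (I : choiceType) (x : I -> R[i]) : abs_summable x ->
  forall e : R[i], 0 < e -> exists J : {fset I}, forall A : {fset I},
    (J `<=` A)%fset ->
    `|csum x - \sum_(i <- A) x i| <= e /\ \sum_(i <- (A `\` J)%fset) `|x i| < e.
Proof.
move=> sx e e0; have [J HJ] := abs_summable_tail sx e0.
exists J => A JA.
have tail (B : {fset I}) : \sum_(i <- (B `\` J)%fset) `|x i| < e.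
  by apply: HJ; apply/fdisjointP => i; rewrite inE => /andP[].
split => //.
have pE (B : {fset I}) : summability.partial_sum (x : I -> R[i]^o) B = \sum_(i <- B) x i.
  by rewrite /summability.partial_sum big_seq_fsetE.
have FF := @summability.totally_filter I.
have cvgx : cvg (summability.partial_sum (x : I -> R[i]^o) @ summability.totally).
  apply: cauchy_cvgc => e1 e10; have [J1 H1] := abs_summable_tail sx e10.
  exists (\sum_(i <- J1) x i); exists J1 => // B /= J1B.
  rewrite pE (sum_fsubset _ J1B) addrC addKr (le_lt_trans (ler_norm_sum _ _ _)) //.
  by apply: H1; apply/fdisjointP => i; rewrite inE => /andP[].
apply/ler_addgt0Pr => e1 e10.
have /cvgrPdist_lt/(_ _ e10)[K _ HK] := cvgx.
have /= := HK (A `|` K)%fset (fsubsetUr _ _).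
rewrite pE (sum_fsubset _ (fsubsetUl A K)) opprD addrA => lt1.
rewrite -(subrK (\sum_(i <- ((A `|` K) `\` A)%fset) x i) (_ - _)).
rewrite (le_trans (ler_normD _ _)) // addrC lerD ?(ltW lt1) //.
rewrite (le_trans (ler_norm_sum _ _ _)) // ltW //.
have -> : ((A `|` K) `\` A = ((A `|` K) `\` A) `\` J)%fset.
  by rewrite fsetDDl (fsetUidPl _ _ JA).
exact: tail.
Qed.

(** Tannery's theorem: a finite [J] carries the convergence, and outside it the bound [K] makes the
    weighted sums small uniformly in n. The limit [l] is the same for every index, so it factors
    out. *)
Lemma csum_tannery (I : choiceType) (x : I -> R[i]) (F : nat -> {fset I})
    (c : nat -> I -> R[i]) (K l : R[i]) :
  0 <= K -> abs_summable x -> (forall n i, `|c n i| <= K) ->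
  (forall i, (fun n => c n i : R[i]^o) @ \oo --> (l : R[i]^o)) ->
  (forall i, \forall n \near \oo, i \in F n) ->
  (fun n => \sum_(i <- F n) c n i * x i : R[i]^o) @ \oo --> (l * csum x : R[i]^o).
Proof.
move=> K0 sx cK cl Fi; apply/cvgrPdist_lt => e e0.
(* Half of e pays for the sum over [J]; the tails cost (|l| + K) e / (2D). The summand 1 keeps [D]
   positive. *)
pose D := 1 + K + `|l|.
have D0 : 0 < D by rewrite /D -addrA ltr_wpDr // addr_ge0.
have d0 : 0 < e / 2 / D by rewrite !divr_gt0.
have [J HJ] := csum_approx sx d0.
have cvgJ : (fun n => \sum_(i <- J) c n i * x i : R[i]^o) @ \oo
    --> (l * \sum_(i <- J) x i : R[i]^o).
  rewrite mulr_sumr; apply: (@cvg_big (R[i]^o)) => [|i _].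
    exact: (@add_continuous (R[i]^o)).
  exact: (@cvgMr_tmp R[i]).
have JF : \forall n \near \oo, (J `<=` F n)%fset.
  apply: filterS (@filter_bigI _ _ J (fun i n => i \in F n) _ _ (fun i _ => Fi i)).
  move=> n Hn; apply/fsubsetP => i iJ; exact: Hn.
have e20 : 0 < e / 2 by rewrite divr_gt0.
move/cvgrPdist_lt/(_ _ e20) in cvgJ.
near=> n.
have JFn : (J `<=` F n)%fset by near: n.
have lt1 : `|l * \sum_(i <- J) x i - \sum_(i <- J) c n i * x i| < e / 2.
  by near: n.
have [le2 _] := HJ _ (fsubset_refl J).
have [_ lt3] := HJ _ JFn.
rewrite (sum_fsubset _ JFn).
set s := \sum_(i <- J) x i in lt1 le2 *; set sc := \sum_(i <- J) _ in lt1 *.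
set t := \sum_(i <- (F n `\` J)%fset) _.
have -> : l * csum x - (sc + t) = (l * s - sc) + (l * (csum x - s) - t) by ring.
rewrite (le_lt_trans (ler_normD _ _)) // (splitr e) ltr_leD //.
have le4 : `|t| <= K * (e / 2 / D).
  rewrite (le_trans (ler_norm_sum _ _ _)) // (le_trans _ (ler_wpM2l K0 (ltW lt3))) //.
  rewrite mulr_sumr; apply: ler_sum => i _; rewrite normrM ler_wpM2r //.
rewrite (le_trans (ler_normB _ _)) // normrM.
rewrite (le_trans (lerD (ler_wpM2l (normr_ge0 l) le2) le4)) //.
rewrite -mulrDl -[leRHS](divfK (lt0r_neq0 D0)) [leRHS]mulrC ler_wpM2r ?(ltW d0) //.
by rewrite /D -addrA (addrC K) lerDr.
Unshelve. all: by end_near. Qed.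

End Convergence.

(** * Infinite products *)

Section InfiniteProducts.
Variable R : realType.

(** By 1 + x <= exp x the product is at most the exponential of a partial geometric sum. *)
Lemma prod_geometric_le (c t : R) n : 0 <= c -> 0 <= t < 1 ->
  \prod_(j < n) (1 + c * t ^+ j) <= expR (c / (1 - t)).
Proof.
move=> c0 /andP[t0 t1]; have t10 : 0 < 1 - t by rewrite subr_gt0.
apply: (@le_trans _ _ (expR (c * (1 - t ^+ n) / (1 - t)))); last first.
  by rewrite ler_expR ler_pM2r ?invr_gt0 // ler_piMr // gerBl exprn_ge0.
elim: n => [|n IH]; first by rewrite big_ord0 subrr mulr0 mul0r expR0.
rewrite big_ord_recr /=.
have -> : c * (1 - t ^+ n.+1) / (1 - t) = c * (1 - t ^+ n) / (1 - t) + c * t ^+ n.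
  by rewrite exprS; field; rewrite gt_eqF.
rewrite expRD ler_pM // ?expR_ge1Dx ?prodr_ge0 // => [i _|];
  by rewrite addr_ge0 // mulr_ge0 // exprn_ge0.
Qed.

Variable q : R[i].
Hypothesis q1 : `|q| < 1.

Lemma prod_geometric_bounded (c : R[i]) : 0 <= c ->
  exists2 K : R[i], 0 <= K & forall n, \prod_(j < n) (1 + c * `|q| ^+ j) <= K.
Proof.
move=> c0; have cE : c = (complex.Re c)%:C by rewrite RRe_real // ger0_real.
exists (expR (complex.Re c / (1 - complex.Re `|q|)))%:C.
  by rewrite ler0c expR_ge0.
have t1 : complex.Re `|q| < 1 by rewrite -ltcR -normcE_Re.
have t0 : 0 <= complex.Re `|q| by rewrite -ler0c -normcE_Re.
move=> n; rewrite cE (normcE_Re q).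
have -> : \prod_(j < n) (1 + (complex.Re c)%:C * (complex.Re `|q|)%:C ^+ j)
    = (\prod_(j < n) (1 + complex.Re c * complex.Re `|q| ^+ j))%:C.
  by rewrite rmorph_prod; apply: eq_bigr => j _; rewrite rmorphD rmorphM rmorphXn.
rewrite lecR prod_geometric_le //.
  by rewrite -ler0c -cE.
by rewrite t0.
Qed.

Lemma qpoch_bounded (x : R[i]) :
  exists2 K : R[i], 0 <= K & forall n, `|qpoch x q n| <= K.
Proof.
have [K K0 HK] := prod_geometric_bounded (normr_ge0 x).
exists K => // n; rewrite (le_trans _ (HK n)) // /qpoch normr_prod.
apply: ler_prod => j _; rewrite normr_ge0 /=.
by rewrite (le_trans (ler_normB _ _)) // normr1 normrM normrX.
Qed.

Lemma one_sub_expr_gt0 (j : nat) : 0 < 1 - `|q| * `|q| ^+ j.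
Proof. by rewrite subr_gt0 -exprS exprn_ilt1. Qed.

Lemma one_sub_expr_ge (j : nat) : 1 - `|q| * `|q| ^+ j <= `|1 - q * q ^+ j|.
Proof. by rewrite -normrX -normrM (le_trans _ (lerB_dist _ _)) // normr1. Qed.

Lemma qpoch_qq_neq0 n : qpoch q q n != 0.
Proof.
apply/prodf_neq0 => j _.
by rewrite -normr_gt0 (lt_le_trans (one_sub_expr_gt0 j)) ?one_sub_expr_ge.
Qed.

Lemma qpoch_inv_bounded :
  exists2 K : R[i], 0 <= K & forall n, `|(qpoch q q n)^-1| <= K.
Proof.
have q10 : 0 < 1 - `|q| by rewrite subr_gt0.
(* For x = |q|^(j+1), 1/(1-x) = 1 + x/(1-x) <= 1 + c |q|^j with this c, since 1 - x >= 1 - |q|. *)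
have c0 : 0 <= `|q| / (1 - `|q|) by rewrite divr_ge0 // ltW.
have [K K0 HK] := prod_geometric_bounded c0.
exists K => // n; rewrite (le_trans _ (HK n)) // /qpoch -prodfV normr_prod.
apply: ler_prod => j _; rewrite normr_ge0 /= normfV.
rewrite (@le_trans _ _ (1 - `|q| * `|q| ^+ j)^-1) //.
  rewrite lef_pV2 ?one_sub_expr_ge // posrE ?one_sub_expr_gt0 //.
  by rewrite (lt_le_trans (one_sub_expr_gt0 j)) ?one_sub_expr_ge.
have f0 := one_sub_expr_gt0 j.
rewrite -[leLHS]mul1r ler_pdivrMr // -subr_ge0.
have -> : (1 + `|q| / (1 - `|q|) * `|q| ^+ j) * (1 - `|q| * `|q| ^+ j) - 1
   = `|q| ^+ 2 * `|q| ^+ j * (1 - `|q| ^+ j) / (1 - `|q|).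
  by field; rewrite gt_eqF.
rewrite divr_ge0 ?(ltW q10) // !mulr_ge0 ?exprn_ge0 // subr_ge0.
by rewrite exprn_ile1 // ltW.
Qed.

Lemma expr_small (e : R[i]) : 0 < e -> \forall n \near \oo, `|q| ^+ n < e.
Proof.
move=> /gt0_complexP[d d0 ->].
have : (fun n => (complex.Re `|q|) ^+ n) @ \oo --> (0 : R).
  by apply: cvg_expr; rewrite -ltcR -normcR -normcE_Re normr_id.
move/cvgrPdist_lt/(_ _ d0); apply: filterS => n.
by rewrite sub0r normrN -ltcR -normcR rmorphXn /= -normcE_Re normrX normr_id.
Qed.

Lemma qpoch_cvg (x : R[i]) :
  (fun n => qpoch x q n : R[i]^o) @ \oo --> (qpoch_inf x q : R[i]^o).
Proof.
suff : cvg ((fun n => qpoch x q n : R[i]^o) @ \oo) by [].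
have [K K0 HK] := qpoch_bounded x.
have q10 : 0 < 1 - `|q| by rewrite subr_gt0.
(* Consecutive products differ by at most K |x| |q|^n; [D] comes from summing this geometric
   series. *)
pose D := K * `|x| / (1 - `|q|).
have D0 : 0 <= D by rewrite divr_ge0 ?mulr_ge0 // ltW.
have step n k : `|qpoch x q (n + k) - qpoch x q n| <= D * `|q| ^+ n * (1 - `|q| ^+ k).
  elim: k => [|k IH]; first by rewrite addn0 !subrr normr0 mulr0.
  rewrite addnS qpochSr mulrBr mulr1 addrAC (le_trans (ler_normB _ _)) //.
  have -> : D * `|q| ^+ n * (1 - `|q| ^+ k.+1)
      = D * `|q| ^+ n * (1 - `|q| ^+ k) + K * (`|x| * `|q| ^+ (n + k)).
    by rewrite /D exprS exprD; field; rewrite gt_eqF.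
  by rewrite lerD // !normrM normrX ler_wpM2r // mulr_ge0 // exprn_ge0.
apply: cauchy_cvgc => e e0.
have D10 : 0 < D + 1 by rewrite ltr_wpDl.
have [N _ HN] := expr_small (divr_gt0 e0 D10).
exists (qpoch x q N); exists N => // n /= Nn.
rewrite -(subnKC Nn) (le_lt_trans (step _ _)) //.
rewrite (@le_lt_trans _ _ (D * `|q| ^+ N)) //.
  apply: ler_piMr; first by rewrite mulr_ge0 // exprn_ge0.
  by rewrite gerBl exprn_ge0.
have := HN N (leqnn N); rewrite /= ltr_pdivlMr // => /(le_lt_trans _); apply.
by rewrite mulrC ler_wpM2l ?exprn_ge0 // lerDl.
Qed.

(** A zero limit would make 1/(q)_n unbounded. *)
Lemma qpoch_inf_neq0 : qpoch_inf q q != 0.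
Proof.
have [K K0 HK] := qpoch_inv_bounded.
have K10 : 0 < K + 1 by rewrite ltr_wpDl.
apply/negP => /eqP E; have := qpoch_cvg (x := q); rewrite E.
have e0 : 0 < (K + 1)^-1 by rewrite invr_gt0.
move/cvgrPdist_lt/(_ _ e0) => [N _ /(_ N (leqnn N)) /=].
rewrite sub0r normrN => lt1.
have := HK N; rewrite normfV => le1.
have PN : 0 < `|qpoch q q N| by rewrite normr_gt0 qpoch_qq_neq0.
have : (K + 1) < K; last by rewrite gtrDl ltr10.
by rewrite (lt_le_trans _ le1) // -ltf_pV2 ?invrK // posrE // invr_gt0.
Qed.

End InfiniteProducts.

(** * The two limits *)

Section Limits.
Variables (R : realType) (q : R[i]).
Hypothesis q1 : `|q| < 1.

Lemma cvg_shift (u : nat -> R[i]^o) (l : R[i]^o) (d r : nat) :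
  u @ \oo --> l -> (fun n => u (n + d - r)%N) @ \oo --> l.
Proof.
move=> ul; apply: (cvg_comp _ _ _ ul) => A [N _ NA].
by exists (N + r)%N => // n /= Nn; apply: NA => /=; lia.
Qed.

(** The quantity [n;k] (q)_k = (q)_n/(q)_(n-k) is the weight that replaces 1/(q)_(n_m) by a
    q-binomial; this bound supplies the domination. *)
Lemma qbinom_qpoch_bounded : exists2 K : R[i], 0 <= K &
  forall n k, `|qbinom q n k * qpoch q q k| <= K.
Proof.
have [K1 K10 H1] := qpoch_bounded q1 q; have [K2 K20 H2] := qpoch_inv_bounded q1.
exists (K1 * K2) => [|n k]; first exact: mulr_ge0.
rewrite /qbinom; case: ifP => _; last by rewrite mul0r normr0 mulr_ge0.
rewrite invfM mulrA (mulfVK (qpoch_qq_neq0 q1 k)) normrM.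
by rewrite ler_pM.
Qed.

Lemma qbinom_qpoch_cvg d k :
  (fun n => qbinom q (n + d) k * qpoch q q k : R[i]^o) @ \oo --> (1 : R[i]^o).
Proof.
have P0 := qpoch_qq_neq0 q1.
have Pinf0 := qpoch_inf_neq0 q1.
have cP := qpoch_cvg q1 (x := q).
have c1 := cvg_shift d 0 cP; have c2 := cvg_shift d k cP.
have H : (fun n => qpoch q q (n + d - 0) / qpoch q q (n + d - k) : R[i]^o) @ \oo
    --> (qpoch_inf q q / qpoch_inf q q : R[i]^o).
  exact: (@cvgM R[i] _ _ _ _ _ _ _ c1 (@cvgV R[i] _ _ _ _ _ Pinf0 c2)).
rewrite -[X in _ --> X](divff Pinf0).
apply: cvg_trans H; apply: near_eq_cvg; exists k => // n /= kn.
rewrite subn0 /qbinom (leq_trans kn) ?leq_addr //.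
by rewrite invfM mulrA mulfVK.
Qed.

Lemma qker_bounded : exists2 K : R[i], 0 <= K & forall k n, `|qker q k n| <= K.
Proof.
have [K1 K10 H1] := qpoch_bounded q1 q; have [K2 K20 H2] := qpoch_inv_bounded q1.
have [K3 K30 H3] := qpoch_bounded q1 (- q).
exists (K3 * K1 * (K2 * K2)) => [|k n]; first by rewrite !mulr_ge0.
rewrite /qker; case: ifP => _; last by rewrite normr0 !mulr_ge0.
by rewrite invfM !normrM !ler_pM ?mulr_ge0.
Qed.

(** The limit does not depend on k, hence becomes the prefactor of the bilateral series. *)
Lemma qker_cvg k : (fun n => qker q k n : R[i]^o) @ \oo -->
  (qpoch_inf (- q) q / qpoch_inf q q : R[i]^o).
Proof.
have Pinf0 := qpoch_inf_neq0 q1.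
have cP := qpoch_cvg q1 (x := q); have cM := qpoch_cvg q1 (x := - q).
have c1 := cvg_shift 0 k cP; have c2 := cvg_shift k.+1 0 cP.
have c3 := @cvgM R[i] _ _ _ _ _ _ _ c1 c2.
have PP0 : qpoch_inf q q * qpoch_inf q q != 0 by rewrite mulf_neq0.
have H : (fun n => qpoch (- q) q n * qpoch q q n
      / (qpoch q q (n + 0 - k) * qpoch q q (n + k.+1 - 0)) : R[i]^o) @ \oo
    --> (qpoch_inf (- q) q * qpoch_inf q q / (qpoch_inf q q * qpoch_inf q q) : R[i]^o).
  exact: (@cvgM R[i] _ _ _ _ _ _ _ (@cvgM R[i] _ _ _ _ _ _ _ cM cP)
    (@cvgV R[i] _ _ _ _ _ PP0 (c3 _))).
have E : qpoch_inf (- q) q / qpoch_inf q q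
   = qpoch_inf (- q) q * qpoch_inf q q / (qpoch_inf q q * qpoch_inf q q) by field.
rewrite [X in _ --> X]E; apply: cvg_trans H; apply: near_eq_cvg; exists k => // n /= kn.
by rewrite /qker kn addn0 subn0 addnS.
Qed.

End Limits.

(** * Truncation of the multiple series to boxes *)

Section Multisum.
Variables (R : realType) (q : R[i]).
Implicit Types (beta : nat -> R[i]).

Lemma multisum_term_chain beta m a (s : m.-tuple nat) n : (0 < m)%N ->
  (forall k, qpoch q q k != 0) ->
  qbinom q (n + (a == m)) (nth 0%N s m.-1) * qpoch q q (nth 0%N s m.-1)
    * multisum_term q beta m a s
  = qpoch (q ^+ 2) (q ^+ 2) (head n s + (a == 0%N)) * beta (head n s + (a == 0%N))%N
    * chain q a 1 s n.
Proof.
case: m s => // m s _ P0; rewrite /multisum_term /chain size_tuple /=.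
have sz := size_tuple s.
(* [chain] has default [n], to read n_(m+1) as n, while [multisum_term] has default 0; they agree
   inside the tuple. *)
have nthE j : (j < m.+1)%N -> nth n s j = nth 0%N s j.
  by move=> jm; apply: set_nth_default; rewrite sz.
rewrite -[head n s]nth0 nthE //.
have -> : \prod_(j < m.+1) (q ^+ 'C((nth n s j).+1, 2)
      * qbinom q (nth n s j.+1 + (a == (1 + j)%N)) (nth n s j))
    = q ^+ (\sum_(1 <= i < m.+2) 'C((nth 0%N s i.-1).+1, 2))
      * (\prod_(1 <= i < m.+1) qbinom q (nth 0%N s i + (a == i)) (nth 0%N s i.-1)
         * qbinom q (n + (a == m.+1)) (nth 0%N s m)).
  rewrite big_split expr_sum !big_add1 /= !big_mkord; congr (_ * _).
    by apply: eq_bigr => j _; rewrite nthE.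
  rewrite big_ord_recr /= add1n (nthE m) // nth_default ?sz //; congr (_ * _).
  by apply: eq_bigr => j _; rewrite !nthE ?ltnS // ltnW.
by field.
Qed.

Definition box (m B : nat) : {fset m.-tuple nat} :=
  [fset s in [seq map_tuple (@nat_of_ord B) t | t : m.-tuple 'I_B]]%fset.

Lemma big_box m B (G : m.-tuple nat -> R[i]) :
  \sum_(s <- box m B) G s = \sum_(t : m.-tuple 'I_B) G (map_tuple (@nat_of_ord B) t).
Proof.
rewrite (perm_big [seq map_tuple (@nat_of_ord B) t | t : m.-tuple 'I_B]).
  by rewrite big_image.
apply: uniq_perm; first exact: fset_uniq.
  rewrite map_inj_uniq ?enum_uniq // => s t /(congr1 val) /= /inj_map E.
  by apply: val_inj; apply: E; exact: ord_inj.
by move=> s; rewrite in_fset.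
Qed.

Lemma near_box m (s : m.-tuple nat) : \forall n \near \oo, s \in box m (n + m).+1.
Proof.
exists (\max_(x <- s) x)%N => // n /= sn; rewrite in_fset.
apply/mapP; exists (map_tuple inord s); first by rewrite mem_enum.
apply: val_inj; rewrite /= -map_comp -[LHS]map_id; apply/eq_in_map => x xs /=.
rewrite inordK // ltnS (leq_trans _ (leq_addr _ _)) // (leq_trans _ sn) //.
exact: leq_bigmax_seq.
Qed.

End Multisum.

(** * Truncation of the bilateral series to intervals *)

Section Bilateral.
Variables (R : realType) (q : R[i]).

(** The interval from -K to K - 1 is stable under k -> -k-1, which exchanges [Posz k] and
    [Negz k]. *)
Definition int_interval (K : nat) : {fset int} :=
  [fset k in [seq Posz k | k <- iota 0 K] ++ [seq Negz k | k <- iota 0 K]]%fset.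

Lemma big_interval K (G : int -> R[i]) :
  \sum_(k <- int_interval K) G k = \sum_(k < K) (G (Posz k) + G (Negz k)).
Proof.
rewrite (perm_big ([seq Posz k | k <- iota 0 K] ++ [seq Negz k | k <- iota 0 K])).
  rewrite big_cat !big_map big_split /=.
  have -> : iota 0 K = index_iota 0 K by rewrite /index_iota subn0.
  by rewrite !big_mkord.
apply: uniq_perm; first exact: fset_uniq.
  rewrite cat_uniq !map_inj_uniq ?iota_uniq; try by move=> ? ? [].
  by rewrite andbT /=; apply/hasPn => _ /mapP[k _ ->]; apply/mapP => -[].
by move=> k; rewrite in_fset.
Qed.

Lemma near_interval d (k : int) : \forall n \near \oo, k \in int_interval (n + d).
Proof.
exists `|k|.+1 => // n /= kn; rewrite in_fset mem_cat.
case: k kn => k kn; apply/orP; [left|right]; apply: map_f; rewrite mem_iota; lia.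
Qed.

Lemma binz2_Posz k : binz2 (Posz k) = Posz 'C(k, 2).
Proof.
rewrite /binz2 bin2; case: k => [|k]; first by rewrite mul0r div0z.
have -> : Posz k.+1 - 1 = Posz k by lia.
by rewrite -PoszM divz_nat divn2.
Qed.

Lemma binz2_Negz k : binz2 (Negz k) = Posz 'C(k.+2, 2).
Proof.
rewrite -binz2_Posz /binz2; congr (_ %/ _)%Z; rewrite NegzE; lia.
Qed.

(** This is K_(j-1) for every integer j, brought to a nonnegative index by K_j = K_(-j-1). *)
Definition qker_int (k : int) (n : nat) : R[i] :=
  match k with Posz k => qker q k.-1 n | Negz k => qker q k.+1 n end.

(** The K_(k-1) part gives the term of index k. Since f_(-k-1) = -q^(2k+1) f_k, the K_(k+1) part
    gives that of index -k-1. The exponents match by C(k+1,2) = C(k,2) + k = C(k+2,2) - (k+1). *)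
Lemma bailey_level_bilateral (f : int -> R[i]) m a k n : q != 0 -> (a <= m)%N ->
  (forall n : int, q ^ n * f n = - (q ^ (- n - 1) * f (- n - 1))) ->
  f (Posz k) * bailey_level q a m k n
  = qker_int (Posz k) n * bilateral_term q f m a (Posz k)
    + qker_int (Negz k) n * bilateral_term q f m a (Negz k).
Proof.
move=> q0 am fE.
have fN : f (Negz k) = - (q ^+ (2 * k + 1) * f (Posz k)).
  have := fE (Posz k).
  have -> : - Posz k - 1 = Negz k by lia.
  move/(congr1 (fun x => q ^+ k.+1 * x)).
  rewrite mulrN mulrA (mulrA _ (q ^ Negz k)) NegzE -exprnN mulfV ?expf_neq0 // mul1r.
  by move=> /(congr1 -%R); rewrite opprK => <-; rewrite -exprnP -exprD;
    congr (- (q ^+ _ * _)); lia.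
rewrite /bailey_level ltnNge am /= /bilateral_term binz2_Posz binz2_Negz fN.
have -> : m%:Z * Posz 'C(k, 2) + a%:Z * Posz k
   = Posz ('C(k.+1, 2) * a + 'C(k, 2) * (m - a)).
  by rewrite binS bin1; move: 'C(k, 2) => c; nia.
have -> : m%:Z * Posz 'C(k.+2, 2) + a%:Z * Negz k
   = Posz ('C(k.+1, 2) * a + 'C(k.+2, 2) * (m - a)).
  by rewrite NegzE [in LHS]binS [in RHS](binS k.+1) bin1; move: 'C(k.+1, 2) => c; nia.
by rewrite -!exprnP !(exprD _ ('C(k.+1, 2) * a)) !exprM; ring.
Qed.

End Bilateral.

(** * Passage to the limit in the finite identity *)

Theorem theorem1p2 (R : realType) (q : R[i]) (hq0 : 0 < `|q|) (hq1 : `|q| < 1)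
    (alpha beta : nat -> R[i]) (hB : bailey_pair q q alpha beta)
    (f : int -> R[i])
    (halpha : forall n : nat,
      alpha n = (1 - q ^+ (2 * n + 1)) / (1 - q) * f n%:Z)
    (hf : forall n : int, q ^ n * f n = - (q ^ (- n - 1) * f (- n - 1)))
    (m a : nat) (hm : (1 <= m)%N) (ha : (a <= m)%N)
    (hL : abs_summable (multisum_term q beta m a))
    (hR : abs_summable (bilateral_term q f m a)) :
  csum (multisum_term q beta m a)
  = qpoch_inf (- q) q / qpoch_inf q q * csum (bilateral_term q f m a).
Proof.
have P0 := qpoch_qq_neq0 hq1.
have q0 : q != 0 by rewrite -normr_gt0.
pose c n (s : m.-tuple nat) : R[i] :=
  qbinom q (n + (a == m)) (nth 0%N s m.-1) * qpoch q q (nth 0%N s m.-1).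
have [K1 K10 HK1] := qbinom_qpoch_bounded hq1.
have cL := csum_tannery (c := c) K10 hL (fun n s => HK1 _ _)
  (fun s => qbinom_qpoch_cvg hq1 _ _) (@near_box m).
have [K2 K20 HK2] := qker_bounded hq1.
have bR n (k : int) : `|qker_int q k n| <= K2 by case: k => k; apply: HK2.
have lR (k : int) : (fun n => qker_int q k n : R[i]^o) @ \oo -->
    (qpoch_inf (- q) q / qpoch_inf q q : R[i]^o).
  by case: k => k; apply: qker_cvg.
(* The initial expansion is needed up to n + m, and at n + m + 1 when a = 0, so the cutoff is n + m
   + 2. *)
have cR := csum_tannery (c := fun n k => qker_int q k n) K20 hR bR lR
  (near_interval (m + 2)).
rewrite mul1r in cL.
(* Both sides are limits of finite sums, which [bailey_steps_level] shows to agree for every n. *)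
apply: (norm_cvg_unique cL); apply: cvg_trans cR.
apply: near_eq_cvg; exists 0%N => // n _ /=.
rewrite big_interval big_box.
pose H l := qpoch (q ^+ 2) (q ^+ 2) (l + (a == 0%N)) * beta (l + (a == 0%N))%N.
transitivity (bailey_steps q (n + m).+1 a 1 m H n); last first.
  rewrite -sum_chain; apply: eq_bigr => s _.
  by rewrite [RHS]multisum_term_chain.
rewrite (@bailey_steps_level _ _ P0 _ (n + (m + 2)) _ _ _ (fun k => f k%:Z)) //.
  by apply: eq_bigr => k _; rewrite bailey_level_bilateral.
move=> l ln; rewrite /H (bailey_pair_qker (f := fun k => f k%:Z) (K := n + (m + 2)) P0 hB halpha).
  by apply: eq_bigr => k _; rewrite bailey_level0.
by case: eqP => _; lia.
Qed.
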